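(* There is an isomorphism between the category $\mathcal{BRRB}$ of bijective relative Rota-Baxter groups and the category $\mathcal{SLB}$ of skew left braces.
   Context: A relative Rota-Baxter group is a quadruple $(H,G,\phi,R)$, where $H$ and $G$ are groups, $\phi: G\to \mathrm{Aut}(H)$, $g\mapsto \phi_g$, is a group homomorphism, and $R:H\to G$ is a map satisfying $R(h_1)R(h_2)=R(h_1\phi_{R(h_1)}(h_2))$ for all $h_1,h_2\in H$. It is called bijective if $R:H\to G$ is a bijection. A homomorphism $(\psi,\eta):(H,G,\phi,R)\to(K,L,\varphi,S)$ of relative Rota-Baxter groups is a pair of group homomorphisms $\psi:H\to K$ and $\eta:G\to L$ such that $\eta\, R=S\,\psi$ and $\psi\,\phi_g=\varphi_{\eta(g)}\,\psi$ for all $g\in G$. The category $\mathcal{BRRB}$ has as objects the bijective relative Rota-Baxter groups and as morphisms the homomorphisms of relative Rota-Baxter groups. A skew left brace is a triple $(H,\cdot,\circ)$ where $(H,\cdot)$ and $(H,\circ)$ are groups such that $a\circ(b\cdot c)=(a\circ b)\cdot a^{-1}\cdot(a\circ c)$ for all $a,b,c\in H$, where $a^{-1}$ is the inverse of $a$ in $(H,\cdot)$. A homomorphism of skew left braces is a map preserving both operations. The category $\mathcal{SLB}$ has as objects the skew left braces and as morphisms the homomorphisms of skew left braces. *)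

(* Defs.v *)
From mathcomp Require Import all_boot boolp.
Set Implicit Arguments.
Unset Strict Implicit.
Unset Printing Implicit Defensive.
Local Obligation Tactic := idtac.

(* Sets.  An isomorphism of categories is a notion about equality of objects.
   Equality of Rocq types is essentially unspecified, so the underlying sets
   of groups are taken to be sets in the sense of set theory: Aczel's
   well-founded trees modulo extensional equality, for which extensionality
   holds as a Leibniz equality ([zset_ext]). *)

Inductive tree : Type := Tree (A : Type) (f : A -> tree).

Fixpoint tree_eq (x y : tree) : Prop :=
  match x, y with
  | Tree A f, Tree B g =>
      (forall a, exists b, tree_eq (f a) (g b)) /\
      (forall b, exists a, tree_eq (f a) (g b))
  end.

Definition tree_in (x y : tree) : Prop :=
  let: Tree B g := y in exists b, tree_eq x (g b).

Record zset : Type := ZSet {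
  zclass : tree -> Prop;
  zclassP : exists x, zclass = tree_eq x
}.

Definition zin (u v : zset) : Prop :=
  exists x y, [/\ zclass u x, zclass v y & tree_in x y].

Definition elt (v : zset) : Type := {u : zset | zin u v}.

Lemma tree_eq_refl x : tree_eq x x.
Proof. by elim: x => A f IH; split=> a; exists a. Qed.

Lemma tree_eq_sym x y : tree_eq x y -> tree_eq y x.
Proof.
elim: x y => A f IH [B g] [fg gf]; split.
  by move=> b; have [a /IH] := gf b; exists a.
by move=> a; have [b /IH] := fg a; exists b.
Qed.

Lemma tree_eq_trans x y z : tree_eq x y -> tree_eq y z -> tree_eq x z.
Proof.
elim: x y z => A f IH [B g] [C h] [fg gf] [gh hg]; split.
  by move=> a; have [b ab] := fg a; have [c bc] := gh b; exists c; apply: IH bc.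
by move=> c; have [b bc] := hg c; have [a ab] := gf b; exists a; apply: IH bc.
Qed.

Lemma zset_eqP u v x y :
  zclass u x -> zclass v y -> u = v <-> tree_eq x y.
Proof.
case: u v => [P Pok] [Q Qok] /= Px Qy; split.
  case=> PQ; move: Px; rewrite {}PQ {Pok}; case: Qok Qy => z -> zy zx.
  exact: tree_eq_trans (tree_eq_sym zx) zy.
move=> xy; have PQ : P = Q.
  case: Pok Px => p -> px; case: Qok Qy => q -> qy.
  have pq := tree_eq_trans (tree_eq_trans px xy) (tree_eq_sym qy).
  apply/funext => t; apply/propext; split; last exact: tree_eq_trans.
  exact: tree_eq_trans (tree_eq_sym pq).
by case: _ / PQ Qok {Qy} => Qok; congr ZSet; exact: Prop_irrelevance.
Qed.

Lemma zset_ext u v : (forall w, zin w u <-> zin w v) -> u = v.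
Proof.
have rep w : exists x, zclass w x.
  by case: w => P [x /= ->]; exists x; apply: tree_eq_refl.
have inE w s x y : zclass w x -> zclass s y -> zin w s <-> tree_in x y.
  move=> wx sy; split; last by exists x, y.
  case=> x' [[B g] [wx' sy']] [b x'b].
  have x'x := proj1 (zset_eqP wx' wx) erefl.
  case: y sy => C h sy; have [gh _] := proj1 (zset_eqP sy' sy) erefl.
  have [c bc] := gh b; exists c.
  exact: tree_eq_trans (tree_eq_sym x'x) (tree_eq_trans x'b bc).
move=> uv; have [[A f] ux] := rep u; have [[B g] vy] := rep v.
apply/(zset_eqP ux vy).
pose cls t : zset := ZSet (ex_intro _ t erefl).
have ct t : zclass (cls t) t by apply: tree_eq_refl.
split=> [a|b].
  apply/(inE _ _ _ _ (ct (f a)) vy)/uv/(inE _ _ _ _ (ct (f a)) ux).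
  by exists a; apply: tree_eq_refl.
have [a ba] : tree_in (g b) (Tree f).
  apply/(inE _ _ _ _ (ct (g b)) ux)/uv/(inE _ _ _ _ (ct (g b)) vy).
  by exists b; apply: tree_eq_refl.
by exists a; apply: tree_eq_sym.
Qed.

(* Groups.  MathComp's [groupType] also carries a choice operator, which would
   count as part of the object here. *)

Record group_on (T : Type) : Type := GroupOn {
  gmul : T -> T -> T;
  gone : T;
  ginv : T -> T;
  gmulA : associative gmul;
  gmul1 : left_id gone gmul;
  gmulr1 : right_id gone gmul;
  gmulV : left_inverse gone ginv gmul;
  gmulrV : right_inverse gone ginv gmul
}.

Record group : Type := Group {
  gset : zset;
  glaw : group_on (elt gset)
}.

Definition gelt (G : group) : Type := elt (gset G).
Coercion gelt : group >-> Sortclass.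

Declare Scope grp_scope.
Delimit Scope grp_scope with grp.
Local Open Scope grp_scope.
Notation "x * y" := (gmul (glaw _) x y) : grp_scope.

Definition is_ghom (G K : group) (f : G -> K) : Prop :=
  forall x y : G, f (x * y) = f x * f y.

Definition is_gaut (G : group) (f : G -> G) : Prop :=
  is_ghom f /\ bijective f.

(* Categories and their strict isomorphisms. *)

Record category : Type := Category {
  ob : Type;
  hom : ob -> ob -> Type;
  idm : forall X, hom X X;
  comp : forall X Y Z, hom Y Z -> hom X Y -> hom X Z;
  comp1m : forall X Y (f : hom X Y), comp (idm Y) f = f;
  compm1 : forall X Y (f : hom X Y), comp f (idm X) = f;
  compA : forall X Y Z W (h : hom Z W) (g : hom Y Z) (f : hom X Y),
    comp h (comp g f) = comp (comp h g) f
}.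
Arguments idm {c} X.
Arguments comp {c X Y Z} g f.

Record functor (C D : category) : Type := Functor {
  fob : ob C -> ob D;
  fmap : forall X Y, hom X Y -> hom (fob X) (fob Y);
  fmap1 : forall X, fmap (idm X) = idm (fob X);
  fmapM : forall X Y Z (g : hom Y Z) (f : hom X Y),
    fmap (comp g f) = comp (fmap g) (fmap f)
}.

Definition functor_id (C : category) : functor C C :=
  @Functor C C id (fun _ _ f => f) (fun _ => erefl) (fun _ _ _ _ _ => erefl).

Program Definition functor_comp (C D E : category)
    (G : functor D E) (F : functor C D) : functor C E :=
  @Functor C E (fun X => fob G (fob F X))
    (fun _ _ f => fmap G (fmap F f)) _ _.
Next Obligation. by move=> C D E G F X /=; rewrite !fmap1. Qed.
Next Obligation. by move=> C D E G F X Y Z g f /=; rewrite !fmapM. Qed.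

Definition isomorphic_categories (C D : category) : Prop :=
  exists (F : functor C D) (G : functor D C),
    functor_comp G F = functor_id C /\ functor_comp F G = functor_id D.

(* Relative Rota-Baxter groups.  [rphi_aut] and [rphi_hom] together say that
   [rphi] is a homomorphism from [rG] to the automorphism group of [rH]. *)

Record rrb_group : Type := RRBGroup {
  rH : group;
  rG : group;
  rphi : rG -> rH -> rH;
  rmap : rH -> rG;
  rphi_aut : forall g, is_gaut (rphi g);
  rphi_hom : forall g1 g2 : rG, rphi (g1 * g2) =1 rphi g1 \o rphi g2;
  rmapP : forall h1 h2 : rH,
    rmap h1 * rmap h2 = rmap (h1 * rphi (rmap h1) h2)
}.

Definition bijective_rrb (X : rrb_group) : Prop := bijective (@rmap X).

Record rrb_hom (X Y : rrb_group) : Type := RRBHom {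
  hpsi : rH X -> rH Y;
  heta : rG X -> rG Y;
  hpsi_hom : is_ghom hpsi;
  heta_hom : is_ghom heta;
  heta_rmap : heta \o @rmap X =1 @rmap Y \o hpsi;
  hpsi_rphi : forall g, hpsi \o rphi g =1 rphi (heta g) \o hpsi
}.

Lemma rrb_hom_eq X Y (f g : rrb_hom X Y) :
  hpsi f = hpsi g -> heta f = heta g -> f = g.
Proof.
case: f g => [p e a1 a2 a3 a4] [q d b1 b2 b3 b4] /= pq ed.
by subst q d; congr RRBHom; apply: Prop_irrelevance.
Qed.

Program Definition rrb_id (X : rrb_group) : rrb_hom X X :=
  @RRBHom X X id id _ _ _ _.
Solve All Obligations with by [].

Program Definition rrb_comp (X Y Z : rrb_group)
    (g : rrb_hom Y Z) (f : rrb_hom X Y) : rrb_hom X Z :=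
  @RRBHom X Z (hpsi g \o hpsi f) (heta g \o heta f) _ _ _ _.
Next Obligation. by move=> X Y Z g f x y /=; rewrite !hpsi_hom. Qed.
Next Obligation. by move=> X Y Z g f x y /=; rewrite !heta_hom. Qed.
Next Obligation.
move=> X Y Z g f x /=.
by have /= -> := heta_rmap f x; have /= -> := heta_rmap g (hpsi f x).
Qed.
Next Obligation.
move=> X Y Z g f u x /=.
by have /= -> := hpsi_rphi f u x; have /= -> := hpsi_rphi g (heta f u) (hpsi f x).
Qed.

Program Definition BRRB : category :=
  @Category {X : rrb_group | bijective_rrb X}
    (fun X Y => rrb_hom (sval X) (sval Y))
    (fun X => rrb_id (sval X))
    (fun _ _ _ g f => rrb_comp g f) _ _ _.
Solve All Obligations with by move=> *; apply: rrb_hom_eq.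

(* Skew left braces. *)

Record skew_brace : Type := SkewBrace {
  bset : zset;
  bdot : group_on (elt bset);
  bcirc : group_on (elt bset);
  bcircP : forall a b c : elt bset,
    gmul bcirc a (gmul bdot b c) =
    gmul bdot (gmul bdot (gmul bcirc a b) (ginv bdot a)) (gmul bcirc a c)
}.

Record brace_hom (A B : skew_brace) : Type := BraceHom {
  bfun : elt (bset A) -> elt (bset B);
  bfun_dot : {morph bfun : a b / gmul (bdot A) a b >-> gmul (bdot B) a b};
  bfun_circ : {morph bfun : a b / gmul (bcirc A) a b >-> gmul (bcirc B) a b}
}.

Lemma brace_hom_eq A B (f g : brace_hom A B) : bfun f = bfun g -> f = g.
Proof.
case: f g => [p a1 a2] [q b1 b2] /= pq.
by subst q; congr BraceHom; apply: Prop_irrelevance.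
Qed.

Program Definition brace_id (A : skew_brace) : brace_hom A A :=
  @BraceHom A A id _ _.
Solve All Obligations with by [].

Program Definition brace_comp (A B C : skew_brace)
    (g : brace_hom B C) (f : brace_hom A B) : brace_hom A C :=
  @BraceHom A C (bfun g \o bfun f) _ _.
Next Obligation. by move=> A B C g f x y /=; rewrite !bfun_dot. Qed.
Next Obligation. by move=> A B C g f x y /=; rewrite !bfun_circ. Qed.

Program Definition SLB : category :=
  @Category skew_brace brace_hom brace_id brace_comp _ _ _.
Solve All Obligations with by move=> *; apply: brace_hom_eq.

(* Main.v *)
From mathcomp Require Import all_boot boolp.
Require Import Defs.
Set Implicit Arguments.
Unset Strict Implicit.
Unset Printing Implicit Defensive.
Local Open Scope grp_scope.

(** A bijective relative Rota-Baxter group [(H, G, phi, R)] is a skew left brace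
on [H], with [a o b = a phi_(R a)(b) = R^-1 (R a R b)], together with a copy [G]
of the set [H], the bijection being [R]: the law of [G] is transported from the
law [o], and [phi] is recovered by [phi_(R a)(b) = a^-1 (a o b)].  A homomorphism
is determined by its component [psi], which can be any brace homomorphism.

So forgetting [G] is fully faithful and essentially surjective, but it is far
from injective on objects, as the set [G] is arbitrary.  To get an isomorphism
and not just an equivalence, the object map has to be changed inside each
isomorphism class.  There are injections both ways between objects, compatible
with isomorphism of braces:
- a brace [A] gives [(A, ., o)] with [R] the identity
  ([rrb_of_brace], [rrb_of_brace_inj]);
- [(H, G, phi, R)] gives its brace moved from [H] to the graph of [R], a set of
  ordered pairs from which [H], [G] and [R] can be read off
  ([graph_braceP], [graph_brace_inj]).
The Cantor-Bernstein construction ([cantor_bernstein_paste]) glues the second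
injection and the inverse of the first into a bijection [F] on objects, still
respecting isomorphism classes: for each [X], the brace of [X] is isomorphic
to [F X] by some [m X] ([models]).  Conjugating by the [m X] makes [F] a fully
faithful functor that is bijective on objects, hence an isomorphism of
categories ([isomorphic_of_bijective]). *)

(** * Functors that are bijective on objects and morphisms *)

(** The composites of a functor with its inverse fix objects only up to a proved
equality, so comparing them with the identity functor means moving morphisms
along equalities of objects. *)
Definition hom_cast (C : category) (X X' Y Y' : ob C) (eX : X = X')
    (eY : Y = Y') (f : hom X Y) : hom X' Y' :=
  ecast Z (hom X' Z) eY (ecast Z (hom Z Y) eX f).

Lemma hom_cast_id (C : category) (X Y : ob C) (eX : X = X) (eY : Y = Y)
  (f : hom X Y) : hom_cast eX eY f = f.
Proof.
by rewrite (Prop_irrelevance eX erefl) (Prop_irrelevance eY erefl).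
Qed.

Lemma hom_cast_trans (C : category) (X X' X'' Y Y' Y'' : ob C)
    (eX : X = X') (eY : Y = Y') (eX' : X' = X'') (eY' : Y' = Y'')
    (f : hom X Y) :
  hom_cast eX' eY' (hom_cast eX eY f) =
  hom_cast (etrans eX eX') (etrans eY eY') f.
Proof. by case: _ / eX'; case: _ / eY'; case: _ / eX; case: _ / eY. Qed.

Lemma hom_cast1 (C : category) (X X' : ob C) (e : X = X') :
  hom_cast e e (idm X) = idm X'.
Proof. by case: _ / e. Qed.

Lemma hom_castM (C : category) (X X' Y Y' Z Z' : ob C) (eX : X = X')
    (eY : Y = Y') (eZ : Z = Z') (g : hom Y Z) (f : hom X Y) :
  hom_cast eX eZ (comp g f) = comp (hom_cast eY eZ g) (hom_cast eX eY f).
Proof. by case: _ / eX; case: _ / eY; case: _ / eZ. Qed.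

Lemma fmap_hom_cast (C D : category) (F : functor C D) (X X' Y Y' : ob C)
    (eX : X = X') (eY : Y = Y') (f : hom X Y) :
  fmap F (hom_cast eX eY f) =
  hom_cast (congr1 (fob F) eX) (congr1 (fob F) eY) (fmap F f).
Proof. by case: _ / eX; case: _ / eY. Qed.

(** Equalities of objects are proof-irrelevant, so once the object maps agree
every cast is the identity and the morphism maps can be compared pointwise. *)
Lemma functor_eq (C D : category) (F G : functor C D)
    (e : forall X, fob F X = fob G X) :
  (forall X Y (f : hom X Y), hom_cast (e X) (e Y) (fmap F f) = fmap G f) ->
  F = G.
Proof.
case: F G e => [Fo Fm F1 FM] [Go Gm G1 GM] /= e FG.
have eFG : Fo = Go by apply/funext.
subst Go; have mFG : Fm = Gm.
  apply: functional_extensionality_dep => X.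
  apply: functional_extensionality_dep => Y.
  by apply/funext => f; rewrite -FG hom_cast_id.
by subst Gm; congr Functor; apply: Prop_irrelevance.
Qed.

(** The inverse functor sends [f] to the preimage under [F] of a cast of [f].
Each law it must satisfy is checked after applying [F], which is injective on
morphisms and commutes with casts. *)
Lemma isomorphic_of_bijective (C D : category) (F : functor C D) :
  bijective (fob F) -> (forall X Y, bijective (@fmap C D F X Y)) ->
  isomorphic_categories C D.
Proof.
move=> [g gK Kg] bijF.
have bijF' X Y : {f' : hom (fob F X) (fob F Y) -> hom X Y |
    cancel (@fmap C D F X Y) f' /\ cancel f' (@fmap C D F X Y)}.
  by apply: cid; have [f' fK Kf] := bijF X Y; exists f'.
pose fi X Y := sval (bijF' X Y).
have fK X Y : cancel (@fmap C D F X Y) (fi X Y) by case: (svalP (bijF' X Y)).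
have Kf X Y : cancel (fi X Y) (@fmap C D F X Y) by case: (svalP (bijF' X Y)).
have injF X Y : injective (@fmap C D F X Y) := can_inj (@fK X Y).
pose Gm X Y (f : hom X Y) : hom (g X) (g Y) :=
  fi _ _ (hom_cast (esym (Kg X)) (esym (Kg Y)) f).
have G1 X : Gm X X (idm X) = idm (g X).
  by apply: injF; rewrite Kf fmap1 hom_cast1.
have GM X Y Z (u : hom Y Z) (f : hom X Y) :
    Gm _ _ (comp u f) = comp (Gm _ _ u) (Gm _ _ f).
  by apply: injF; rewrite fmapM !Kf -hom_castM.
pose G := Functor G1 GM; exists F, G; split.
  apply: (@functor_eq _ _ (functor_comp G F) (functor_id C) gK) => X Y f /=.
  by apply: injF; rewrite fmap_hom_cast Kf hom_cast_trans hom_cast_id.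
apply: (@functor_eq _ _ (functor_comp F G) (functor_id D) Kg) => X Y f /=.
by rewrite Kf hom_cast_trans hom_cast_id.
Qed.

(** * The Cantor-Bernstein construction *)

(** The last clause is what keeps the bijection inside any relation between
[A] and [B] that contains both the graph of [f] and the converse of that
of [g]. *)
Lemma cantor_bernstein_paste (A B : Type) (f : A -> B) (g : B -> A) :
  injective f -> injective g ->
  exists2 h : A -> B, bijective h & forall x, h x = f x \/ g (h x) = x.
Proof.
move=> injf injg.
(* [x] is initial when going back and forth along [g] and [f] from [x] ends
   outside the image of [g]; such points are sent by [f], others by [g^-1]. *)
pose initial x := exists n z, (forall y, g y <> z) /\ x = iter n (g \o f) z.
have initial_gf x : initial (g (f x)) -> initial x.
  case=> [[|n]] [z] [gz /=]; first by move=> /gz.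
  by move=> /injg /injf ->; exists n, z.
pose P x y := (initial x /\ y = f x) \/ (~ initial x /\ g y = x).
have totP x : exists y, P x y.
  have [ix|nix] := pselect (initial x); first by exists (f x); left.
  have [[y gy]|ngy] := pselect (exists y, g y = x); first by exists y; right.
  by case: nix; exists 0, x; split=> // y gy; apply: ngy; exists y.
have [h hP] := choice totP.
exists h; last by move=> x; case: (hP x) => -[_]; [left|right].
have injh x1 x2 : h x1 = h x2 -> x1 = x2.
  move=> e; case: (hP x1) => -[i1 h1]; case: (hP x2) => -[i2 h2].
  - by apply: injf; rewrite -h1 e.
  - case: i2; rewrite -h2 -e h1; case: i1 => n [z [gz ->]].
    by exists n.+1, z.
  - case: i1; rewrite -h1 e h2; case: i2 => n [z [gz ->]].
    by exists n.+1, z.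
  - by rewrite -h1 e.
have surh y : exists x, h x = y.
  have [igy|nigy] := pselect (initial (g y)).
    case: (igy) => [[|n]] [z] [gz /= e]; first by case: (gz y).
    exists (iter n (g \o f) z); move/injg: e => ->.
    by case: (hP (iter n (g \o f) z)) => -[ni // _]; case: ni; exists n, z.
  exists (g y); case: (hP (g y)) => -[i]; first by case: nigy.
  exact: injg.
have [k hk] := choice surh.
by exists k => // x; apply: injh; rewrite hk.
Qed.

(** * Sets, ordered pairs and replacement *)

Definition zclass_of (x : tree) : zset := ZSet (ex_intro _ x erefl).

Lemma zclass_ofP x : zclass (zclass_of x) x.
Proof. exact: tree_eq_refl. Qed.

Lemma zclass_of_eq x y : zclass_of x = zclass_of y <-> tree_eq x y.
Proof. exact: (zset_eqP (zclass_ofP x) (zclass_ofP y)). Qed.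

Lemma zset_repP (u : zset) : exists x, u = zclass_of x.
Proof.
case: u => P [x Px]; exists x; subst P; congr ZSet; exact: Prop_irrelevance.
Qed.

(** The bridge from trees to sets: below it, sets are handled only through
families of members. *)
Lemma zin_Tree A (f : A -> tree) w :
  zin w (zclass_of (Tree f)) <-> exists a, w = zclass_of (f a).
Proof.
split=> [[x [[B g] [wx [_ gf] [b xb]]]]|[a ->]].
  have [a ab] := gf b; exists a.
  exact/(zset_eqP wx (zclass_ofP _))/(tree_eq_trans xb (tree_eq_sym ab)).
exists (f a), (Tree f); split; try exact: zclass_ofP.
by exists a; apply: tree_eq_refl.
Qed.

(** The index type is a type of the universe in which trees branch, which
[elt v] is not: this is why replacement goes through [zfam_of]. *)
Lemma zfam_ex (A : Type) (F : A -> zset) :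
  exists v, forall w, zin w v <-> exists a, w = F a.
Proof.
have [f fF] := choice (fun a => zset_repP (F a)).
exists (zclass_of (Tree f)) => w; rewrite zin_Tree.
by split=> -[a ->]; exists a; rewrite fF.
Qed.

Lemma zfam_of (v : zset) :
  exists (A : Type) (F : A -> zset), forall w, zin w v <-> exists a, w = F a.
Proof.
have [[A f] ->] := zset_repP v.
by exists A, (fun a => zclass_of (f a)) => w; apply: zin_Tree.
Qed.

Lemma zreplacement (v : zset) (F : elt v -> zset) :
  exists e, forall w, zin w e <-> exists a, w = F a.
Proof.
have [A [f vf]] := zfam_of v.
have fv a : zin (f a) v by apply/vf; exists a.
have [e eP] := zfam_ex (fun a => F (exist _ (f a) (fv a))).
exists e => w; rewrite eP; split=> -[a ->]; first by eexists.
case: a => u uv; have [a ua] := proj1 (vf u) uv; subst u.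
by exists a; congr F; congr exist; apply: Prop_irrelevance.
Qed.

Lemma upair_ex (u v : zset) : exists p, forall w, zin w p <-> w = u \/ w = v.
Proof.
have [p pP] := zfam_ex (fun b : bool => if b then u else v).
exists p => w; rewrite pP; split=> [[[] ->]|[->|->]]; [by left|by right| |].
  by exists true.
by exists false.
Qed.

Definition upair (u v : zset) : zset := sval (cid (upair_ex u v)).

Lemma upairP u v w : zin w (upair u v) <-> w = u \/ w = v.
Proof. exact: (svalP (cid (upair_ex u v))). Qed.

Lemma upair_inj u v u' v' : upair u v = upair u' v' ->
  (u = u' /\ v = v') \/ (u = v' /\ v = u').
Proof.
move=> e; have E w : (w = u \/ w = v) <-> (w = u' \/ w = v').
  by rewrite -!upairP e.
have := proj1 (E u) (or_introl erefl); have := proj1 (E v) (or_intror erefl).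
have := proj2 (E u') (or_introl erefl); have := proj2 (E v') (or_intror erefl).
by do 4!case=> ?; subst; auto.
Qed.

(** Kuratowski's ordered pair. *)
Definition opair (u v : zset) : zset := upair (upair u u) (upair u v).

Lemma opair_inj u v u' v' : opair u v = opair u' v' -> u = u' /\ v = v'.
Proof.
by case/upair_inj=> -[/upair_inj e1 /upair_inj e2];
  case: e1 => -[? ?]; case: e2 => -[? ?]; subst.
Qed.

(** * Groups *)

Lemma gmulKl T (g : group_on T) (a b c : T) :
  gmul g a b = gmul g a c -> b = c.
Proof.
by move=> e; rewrite -(gmul1 g b) -(gmul1 g c) -(gmulV g a) -!gmulA e.
Qed.

Lemma group_on_eq T (g k : group_on T) : gmul g =2 gmul k -> g = k.
Proof.
move=> gk; have e1 : gone g = gone k.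
  by rewrite -(gmulr1 k (gone g)) -gk gmul1.
have eV : ginv g = ginv k.
  apply/funext => a; apply: (@gmulKl _ g a).
  by rewrite gmulrV gk gmulrV.
have {gk} eM : gmul g = gmul k by do 2!apply/funext => ?; apply: gk.
case: g k e1 eV eM => [m o i ? ? ? ? ?] [m' o' i' ? ? ? ? ?] /= ? ? ?.
by subst; congr GroupOn; apply: Prop_irrelevance.
Qed.

Lemma Group_inj v (g g' : group_on (elt v)) : Group g = Group g' -> g = g'.
Proof.
move=> e.
have [p] : exists p : gset (Group g) = gset (Group g'),
    ecast u (group_on (elt u)) p (glaw (Group g)) = glaw (Group g').
  by case: _ / e; exists erefl.
by rewrite /= in p *; rewrite (Prop_irrelevance p erefl).
Qed.

Section Transport.

Variables (T U : Type) (g : group_on T) (f : T -> U) (f' : U -> T).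
Hypotheses (fK : cancel f f') (Kf : cancel f' f).

Let mul x y := f (gmul g (f' x) (f' y)).
Let inv x := f (ginv g (f' x)).

Lemma transport_mulA : associative mul.
Proof. by move=> x y z; rewrite /mul !fK gmulA. Qed.

Lemma transport_mul1 : left_id (f (gone g)) mul.
Proof. by move=> x; rewrite /mul fK gmul1. Qed.

Lemma transport_mulr1 : right_id (f (gone g)) mul.
Proof. by move=> x; rewrite /mul fK gmulr1. Qed.

Lemma transport_mulV : left_inverse (f (gone g)) inv mul.
Proof. by move=> x; rewrite /mul /inv !fK gmulV. Qed.

Lemma transport_mulrV : right_inverse (f (gone g)) inv mul.
Proof. by move=> x; rewrite /mul /inv !fK gmulrV. Qed.

Definition transport : group_on U :=
  GroupOn transport_mulA transport_mul1 transport_mulr1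
    transport_mulV transport_mulrV.

End Transport.

(** * The brace of a bijective relative Rota-Baxter group *)

(** [models X A m]: the bijection [m] is an isomorphism from the skew left brace
of [X], whose second law is [a o b = a phi_(R a)(b)], onto [A]. *)
Definition models (X : rrb_group) (A : skew_brace)
    (m : rH X -> elt (bset A)) : Prop :=
  [/\ bijective m,
      {morph m : a b / a * b >-> gmul (bdot A) a b} &
      forall a b, m (a * rphi (rmap a) b) = gmul (bcirc A) (m a) (m b)].

Lemma rphiM (X : rrb_group) g (a b : rH X) :
  rphi g (a * b) = rphi g a * rphi g b.
Proof. by have [h _] := rphi_aut g; apply: h. Qed.

(** The carrier [v] is an arbitrary copy of the set [H], so that it can be chosen
to remember [G] and [R]. *)
Section BraceOn.

Variables (X : rrb_group) (r : rG X -> rH X).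
Hypotheses (rmapK : cancel (@rmap X) r) (rK : cancel r (@rmap X)).
Variables (v : zset) (m : rH X -> elt v) (m' : elt v -> rH X).
Hypotheses (mK : cancel m m') (m'K : cancel m' m).

Let dot := transport (glaw (rH X)) mK m'K.
Let circ := transport (glaw (rG X)) (can_comp mK rK) (can_comp rmapK m'K).

Lemma circE a b : gmul circ (m a) (m b) = m (a * rphi (rmap a) b).
Proof. by rewrite /= !mK rmapP rmapK. Qed.

Lemma dotE a b : gmul dot (m a) (m b) = m (a * b).
Proof. by rewrite /= !mK. Qed.

(** Read on [H], both sides are [a phi_(R a)(b) phi_(R a)(c)], because [phi_(R a)]
is multiplicative. *)
Lemma circ_dot a b c : gmul circ a (gmul dot b c) =
  gmul dot (gmul dot (gmul circ a b) (ginv dot a)) (gmul circ a c).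
Proof.
rewrite -[a]m'K -[b]m'K -[c]m'K; move: (m' a) (m' b) (m' c) => x y z.
have -> : ginv dot (m x) = m (ginv (glaw (rH X)) x) by rewrite /= mK.
rewrite !(dotE, circE) rphiM -!gmulA; congr (m (_ * (_ * _))).
by rewrite gmulA gmulV gmul1.
Qed.

Definition brace_on : skew_brace := SkewBrace circ_dot.

Lemma models_brace_on : @models X brace_on m.
Proof.
split; first by exists m'.
  by move=> a b; rewrite -dotE.
by move=> a b; rewrite -circE.
Qed.

End BraceOn.

(** * Injections between objects *)

(** [A] is the brace of [X], on the graph of [R] as carrier. *)
Definition models_graph (X : rrb_group) (A : skew_brace) : Prop :=
  exists2 m : rH X -> elt (bset A), models m &
    forall a, sval (m a) = opair (sval a) (sval (rmap a)).

Lemma sval_elt_inj v : injective (fun a : elt v => sval a).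
Proof.
by case=> a va [b vb] /= ab; subst b; congr exist; apply: Prop_irrelevance.
Qed.

Lemma graph_braceP (X : rrb_group) :
  bijective_rrb X -> exists A, models_graph X A.
Proof.
case=> r rmapK rK.
pose F (a : rH X) := opair (sval a) (sval (rmap a)).
have [v vP] := @zreplacement (gset (rH X)) F.
have vF a : zin (F a) v by apply/vP; exists a.
pose m a : elt v := exist _ (F a) (vF a).
have inv (b : elt v) : exists a, m a = b.
  case: b => w vw; have [a wa] := proj1 (vP w) vw; exists a.
  by apply: sval_elt_inj; rewrite /= wa.
have [m' m'K] := choice inv.
have mK : cancel m m'.
  move=> a; have /opair_inj[aa _] := congr1 sval (m'K (m a)).
  exact: sval_elt_inj.
by exists (brace_on rmapK rK mK m'K), m; first exact: models_brace_on.
Qed.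

(** The members of the carrier of [A] are the pairs [(a, R a)] for [X], and also
those for [Y], so the two graphs agree. *)
Lemma models_graph_sub (X Y : rrb_group) (A : skew_brace) :
  models_graph X A -> models_graph Y A ->
  forall a : rH X, exists b : rH Y,
    sval a = sval b /\ sval (rmap a) = sval (rmap b).
Proof.
move=> [m _ mE] [n [[n' _ n'K] _ _] nE] a; exists (n' (m a)).
by apply: opair_inj; rewrite -mE -nE n'K.
Qed.

Lemma models_graph_sets (X Y : rrb_group) (A : skew_brace) :
  bijective_rrb X -> models_graph X A -> models_graph Y A ->
  (forall w, zin w (gset (rH X)) -> zin w (gset (rH Y))) /\
  (forall w, zin w (gset (rG X)) -> zin w (gset (rG Y))).
Proof.
move=> [r _ rK] XA YA; have sub := models_graph_sub XA YA.
split=> w vw.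
  by have [b [/= e _]] := sub (exist _ w vw); rewrite e; apply: (svalP b).
have [b [_]] := sub (r (exist _ w vw)).
by rewrite rK /= => ->; apply: (svalP (rmap b)).
Qed.

(** The graph gives the sets [H] and [G] and the map [R], hence also [m]; the
laws of [A] then give the rest: the first one is the law of [H], the second
one gives [phi] by cancelling [a] in [a phi_(R a)(b)], and the law of [G] is
forced by the Rota-Baxter identity, as [R] is onto. *)
Lemma graph_brace_inj (X Y : rrb_group) (A : skew_brace) :
  bijective_rrb X -> bijective_rrb Y ->
  models_graph X A -> models_graph Y A -> X = Y.
Proof.
move=> bX bY XA YA.
have [HXY GXY] := models_graph_sets bX XA YA.
have [HYX GYX] := models_graph_sets bY YA XA.
have eH : gset (rH X) = gset (rH Y).
  by apply: zset_ext => w; split=> [/HXY|/HYX].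
have eG : gset (rG X) = gset (rG Y).
  by apply: zset_ext => w; split=> [/GXY|/GYX].
have sub := models_graph_sub XA YA.
move: bX XA YA sub; clear bY HXY GXY HYX GYX.
case: X Y eH eG => [[H h] [G g] phi R aut hom RP].
case=> [[H' h'] [G' g'] phi' R' aut' hom' RP'] /= eH eG; subst H' G'.
move=> [/= r rK Kr] [/= m [[m' mK m'K] mM mC] mE] [/= n [_ nM nC] nE] sub.
rewrite /bijective_rrb /= in r rK Kr m m' mK m'K mM mC mE n nM nC nE sub *.
have eR : R = R'.
  apply/funext => a; have [b [/sval_elt_inj <-]] := sub a.
  exact: sval_elt_inj.
subst R'; have em : m = n.
  by apply/funext => a; apply: sval_elt_inj; rewrite mE nE.
subst n; have eh : h = h'.
  apply: group_on_eq => a b; apply: (can_inj mK).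
  by have /= -> := mM a b; have /= -> := nM a b.
subst h'; have ephi : phi = phi'.
  apply/funext => x; apply/funext => b; rewrite -[x]Kr.
  apply: (@gmulKl _ h (r x)); apply: (can_inj mK).
  by have /= -> := mC (r x) b; have /= -> := nC (r x) b.
subst phi'; have eg : g = g'.
  apply: group_on_eq => x y; rewrite -[x]Kr -[y]Kr.
  by have /= -> := RP (r x) (r y); have /= -> := RP' (r x) (r y).
by subst g'; congr RRBGroup; apply: Prop_irrelevance.
Qed.

(** On the brace side, [a |-> (b |-> a^-1 (a o b))] is an action of [(A, o)] on
[(A, .)] by automorphisms, for which the identity map is a Rota-Baxter
operator. *)
Section RrbOfBrace.

Variable A : skew_brace.

Local Notation dot := (gmul (bdot A)).
Local Notation inv := (ginv (bdot A)).
Local Notation circ := (gmul (bcirc A)).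

Definition brace_lambda (a b : elt (bset A)) : elt (bset A) :=
  dot (inv a) (circ a b).

Lemma dot_lambda a b : dot a (brace_lambda a b) = circ a b.
Proof. by rewrite /brace_lambda gmulA gmulrV gmul1. Qed.

Lemma brace_lambda_dot a : {morph brace_lambda a : b c / dot b c}.
Proof. by move=> b c; rewrite /brace_lambda bcircP -!gmulA. Qed.

(** Expanding [a o (b o c)] as [a o (b . lambda_b c)] with the brace identity
gives [(a o b) . lambda_a (lambda_b c)]. *)
Lemma brace_lambda_circ a b :
  brace_lambda (circ a b) =1 brace_lambda a \o brace_lambda b.
Proof.
move=> c; apply: (@gmulKl _ (bdot A) (circ a b)).
by rewrite dot_lambda -gmulA -(dot_lambda b c) bcircP -gmulA.
Qed.

(** The unit [e] of [o] is not yet known to be that of the first law, so the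
argument is that [lambda_e] is idempotent and that [e . lambda_e b = b] makes
it injective. *)
Lemma brace_lambda_one : brace_lambda (gone (bcirc A)) =1 id.
Proof.
move=> b; set e := gone _.
have ee : brace_lambda e (brace_lambda e b) = brace_lambda e b.
  by have /= <- := brace_lambda_circ e e b; rewrite gmul1.
by have := congr1 (dot e) ee; rewrite !dot_lambda !gmul1.
Qed.

Lemma brace_lambda_bij a : bijective (brace_lambda a).
Proof.
by exists (brace_lambda (ginv (bcirc A) a)) => b;
  [have /= <- := brace_lambda_circ (ginv (bcirc A) a) a b; rewrite gmulV
  |have /= <- := brace_lambda_circ a (ginv (bcirc A) a) b; rewrite gmulrV];
  apply: brace_lambda_one.
Qed.

Lemma brace_lambda_aut a : @is_gaut (Group (bdot A)) (brace_lambda a).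
Proof. by split; [apply: brace_lambda_dot | apply: brace_lambda_bij]. Qed.

Definition rrb_of_brace : rrb_group :=
  @RRBGroup (Group (bdot A)) (Group (bcirc A)) brace_lambda id
    brace_lambda_aut brace_lambda_circ (fun a b => esym (dot_lambda a b)).

Lemma rrb_of_brace_bij : bijective_rrb rrb_of_brace.
Proof. by exists id. Qed.

Lemma models_rrb_of_brace : @models rrb_of_brace A id.
Proof. by split=> //; [exists id | apply: dot_lambda]. Qed.

End RrbOfBrace.

(** The laws of the two groups are the laws of the brace, on the same set. *)
Lemma rrb_of_brace_inj : injective rrb_of_brace.
Proof.
move=> A B AB; have := congr1 rH AB; have := congr1 rG AB; clear AB.
case: A B => [v d c P] [v' d' c' P'] /= eG eH.
have ev := congr1 gset eG; rewrite /= in ev; subst v'.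
move/Group_inj: eG => ?; move/Group_inj: eH => ?; subst.
by congr SkewBrace; apply: Prop_irrelevance.
Qed.

(** * The isomorphism of categories *)

(** A homomorphism is determined by its first component [psi], since
[eta = S psi R^-1]; and [psi] preserves the laws [a phi_(R a)(b)] exactly when
this [eta] makes [(psi, eta)] a homomorphism.  Through the isomorphisms [m] and
[n], homomorphisms from [X] to [Y] are thus those from [A] to [B]. *)
Section Conjugation.

Variables (X Y : rrb_group) (A B : skew_brace).
Variables (m : rH X -> elt (bset A)) (n : rH Y -> elt (bset B)).
Variables (m' : elt (bset A) -> rH X) (n' : elt (bset B) -> rH Y).
Hypotheses (mA : models m) (nB : models n).
Hypotheses (mK : cancel m m') (m'K : cancel m' m).
Hypotheses (nK : cancel n n') (n'K : cancel n' n).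

Lemma conj_dot (f : rrb_hom X Y) :
  {morph n \o hpsi f \o m' : a b / gmul (bdot A) a b >-> gmul (bdot B) a b}.
Proof.
move=> a b /=; have [_ mM _] := mA; have [_ nM _] := nB.
by rewrite -nM -hpsi_hom -{1}[a]m'K -{1}[b]m'K -mM mK.
Qed.

Lemma conj_circ (f : rrb_hom X Y) :
  {morph n \o hpsi f \o m' : a b / gmul (bcirc A) a b >-> gmul (bcirc B) a b}.
Proof.
move=> a b /=; have [_ _ mC] := mA; have [_ _ nC] := nB.
rewrite -nC -{1}[a]m'K -{1}[b]m'K -mC mK hpsi_hom.
have /= -> := hpsi_rphi f (rmap (m' a)) (m' b).
by have /= -> := heta_rmap f (m' a).
Qed.

Definition conj_hom (f : rrb_hom X Y) : brace_hom A B :=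
  BraceHom (conj_dot f) (conj_circ f).

Lemma rrb_hom_psi_inj (f g : rrb_hom X Y) :
  bijective_rrb X -> hpsi f = hpsi g -> f = g.
Proof.
move=> [r _ rK] fg; apply: rrb_hom_eq => //; apply/funext => x.
rewrite -[x]rK; have /= -> := heta_rmap f (r x).
by have /= -> := heta_rmap g (r x); rewrite fg.
Qed.

Lemma conj_hom_inj : bijective_rrb X -> injective conj_hom.
Proof.
move=> bX f g /(congr1 (@bfun A B)) /= fg; apply: rrb_hom_psi_inj => //.
apply/funext => a; have := congr1 (fun u => n' (u (m a))) fg.
by rewrite /= mK !nK.
Qed.

Lemma conj_hom_surj : bijective_rrb X ->
  forall u, exists f, conj_hom f = u.
Proof.
move=> [r Rr rR] u; have [_ mM mC] := mA; have [_ nM nC] := nB.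
pose psi a := n' (bfun u (m a)); pose eta x := rmap (psi (r x)).
have psiM : is_ghom psi.
  by move=> a b; apply: (can_inj nK); rewrite n'K mM bfun_dot nM !n'K.
have psiC a b : psi (a * rphi (rmap a) b) = psi a * rphi (rmap (psi a)) (psi b).
  by apply: (can_inj nK); rewrite n'K mC bfun_circ nC !n'K.
have etaM : is_ghom eta.
  move=> x y; rewrite /eta -{1}[x]rR -{1}[y]rR rmapP Rr psiC.
  by rewrite -rmapP.
have etaR : eta \o @rmap X =1 @rmap Y \o psi by move=> a; rewrite /eta /= Rr.
have psi_phi g : psi \o rphi g =1 rphi (eta g) \o psi.
  move=> b /=; rewrite /eta -{1}[g]rR.
  by apply: (@gmulKl _ (glaw (rH Y)) (psi (r g))); rewrite -psiC psiM.
exists (RRBHom psiM etaM etaR psi_phi); apply: brace_hom_eq.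
by apply/funext => a; rewrite /= /psi m'K n'K.
Qed.

Lemma conj_hom_bij : bijective_rrb X -> bijective conj_hom.
Proof.
move=> bX; have [k kK] := choice (conj_hom_surj bX).
by exists k => // f; apply: (conj_hom_inj bX); rewrite kK.
Qed.

End Conjugation.

Theorem theorem4p6 : isomorphic_categories BRRB SLB.
Proof.
have [G GP] := choice (fun X : ob BRRB => graph_braceP (svalP X)).
pose K (A : ob SLB) : ob BRRB := exist _ _ (rrb_of_brace_bij A).
have injG : injective G.
  move=> X Y e; case: X Y e (GP X) (GP Y) => [X bX] [Y bY] /= -> XA YA.
  have XY := graph_brace_inj bX bY XA YA; subst Y.
  by congr exist; apply: Prop_irrelevance.
have injK : injective K by move=> A B /(congr1 sval) /rrb_of_brace_inj.
have [F bijF FP] := cantor_bernstein_paste injG injK.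
(* Where [F X] is the graph brace, [m X] is the map to the graph; where [X] comes
   from the brace [F X], it is the identity. *)
have m_ex X : {mm : (rH (sval X) -> elt (bset (F X))) *
    (elt (bset (F X)) -> rH (sval X)) |
    [/\ models mm.1, cancel mm.1 mm.2 & cancel mm.2 mm.1]}.
  apply: cid; suff [m mP] : exists m, @models (sval X) (F X) m.
    by have [[m' mK m'K] _ _] := mP; exists (m, m').
  case: (FP X) => e; first by rewrite e; have [m mP _] := GP X; exists m.
  have : exists m, @models (sval (K (F X))) (F X) m.
    by exists id; apply: models_rrb_of_brace.
  by rewrite e.
pose m X := (sval (m_ex X)).1; pose m' X := (sval (m_ex X)).2.
have mP X : models (m X) by case: (svalP (m_ex X)).
have mK X : cancel (m X) (m' X) by case: (svalP (m_ex X)).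
have m'K X : cancel (m' X) (m X) by case: (svalP (m_ex X)).
pose Fm (X Y : ob BRRB) (f : hom X Y) : @hom SLB (F X) (F Y) :=
  conj_hom (mP X) (mP Y) (mK X) (m'K X) f.
have F1 X : Fm X X (idm X) = idm (F X : ob SLB).
  by apply: brace_hom_eq; apply/funext => a; rewrite /= m'K.
have FM X Y Z (g : hom Y Z) (f : hom X Y) :
    Fm _ _ (comp g f) = comp (Fm _ _ g) (Fm _ _ f).
  by apply: brace_hom_eq; apply/funext => a; rewrite /= mK.
apply: (@isomorphic_of_bijective _ _ (Functor F1 FM)) => //= X Y.
by apply: conj_hom_bij (svalP X).
Qed.
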